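(* The public announcement logics PALFI1 and PALFI1$_C$ coincide: for every formula $\alpha\in\mathcal{L}_{PA}$, $\vdash_{PALFI1}\alpha$ iff $\vdash_{PALFI1_C}\alpha$.
   Context: **Language.** $P$ is a countable set of propositional variables, $N$ a finite set of agents. $\mathcal{L}_{PA}$: $\alpha ::= p \mid \neg\alpha \mid \bullet\alpha \mid (\alpha\land\alpha) \mid K_i\alpha \mid [\alpha]\alpha$ with $p\in P$, $i\in N$ ($[\alpha]\beta$: after public announcement of $\alpha$, $\beta$). **Abbreviations.** $\circ\alpha:=\neg\bullet\alpha$; $\alpha\lor\beta:=\neg(\neg\alpha\land\neg\beta)$; $\sim\!\alpha:=\neg\alpha\land\circ\alpha$; $\alpha\to\beta:=\ \sim\!\alpha\lor\beta$; $\alpha\leftrightarrow\beta:=(\alpha\to\beta)\land(\beta\to\alpha)$; $\alpha\equiv\beta:=(\alpha\leftrightarrow\beta)\land(\neg\alpha\leftrightarrow\neg\beta)$; $\hat K_i\alpha:=\neg K_i\neg\alpha$. **Base system S5LFI1** (schemata over all formulas of $\mathcal{L}_{PA}$): A1 $\alpha\to(\beta\to\alpha)$; A2 $(\alpha\to(\beta\to\gamma))\to((\alpha\to\beta)\to(\alpha\to\gamma))$; A3 $\alpha\to(\beta\to(\alpha\land\beta))$; A4 $(\alpha\land\beta)\to\alpha$; A5 $(\alpha\land\beta)\to\beta$; A6 $\alpha\to(\alpha\lor\beta)$; A7 $\beta\to(\alpha\lor\beta)$; A8 $(\alpha\to\gamma)\to((\beta\to\gamma)\to((\alpha\lor\beta)\to\gamma))$;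 A9 $\alpha\lor(\alpha\to\beta)$; A10 $\alpha\lor\neg\alpha$; A11 $\circ\alpha\to(\alpha\to(\neg\alpha\to\beta))$; A12 $\bullet\alpha\to(\alpha\land\neg\alpha)$; A13 $\neg\neg\alpha\leftrightarrow\alpha$; A14 $\neg(\alpha\lor\beta)\leftrightarrow(\neg\alpha\land\neg\beta)$; A15 $\neg(\alpha\land\beta)\leftrightarrow(\neg\alpha\lor\neg\beta)$; A16 $\neg(\alpha\to\beta)\leftrightarrow(\alpha\land\neg\beta)$; MP: $\alpha,\alpha\to\beta\Rightarrow\beta$; K $K_i(\alpha\to\beta)\to(K_i\alpha\to K_i\beta)$; K$_1$ $K_i(\alpha\to\beta)\to(\hat K_i\alpha\to\hat K_i\beta)$; K$_2$ $\hat K_i(\alpha\lor\beta)\to(\hat K_i\alpha\lor\hat K_i\beta)$; K$_3$ $(\hat K_i\alpha\to K_i\beta)\to K_i(\alpha\to\beta)$; T $K_i\alpha\to\alpha$; 4 $K_i\alpha\to K_iK_i\alpha$; 5 $\hat K_i\alpha\to K_i\hat K_i\alpha$; T$'$ $\alpha\to\hat K_i\alpha$; 4$'$ $\hat K_i\hat K_i\alpha\to\hat K_i\alpha$; 5$'$ $\hat K_iK_i\alpha\to K_i\alpha$; Nec: $\alpha\Rightarrow K_i\alpha$; and $\equiv$ is a congruence for $K_i$, taken as the rule $\alpha\equiv\beta\Rightarrow K_i\alpha\equiv K_i\beta$. **Announcement axioms.** PA1 $[\alpha]p\equiv(\alpha\to p)$; PA2 $[\alpha]\neg\beta\equiv(\alpha\to\neg[\alpha]\beta)$;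 PA3 $[\alpha]\bullet\beta\equiv(\alpha\to\bullet[\alpha]\beta)$; PA4 $[\alpha](\beta\land\gamma)\equiv([\alpha]\beta\land[\alpha]\gamma)$; PA5 $[\alpha]K_i\beta\equiv(\alpha\to K_i[\alpha]\beta)$. **PALFI1** = S5LFI1 + PA1–PA5 + rule RE: $\theta\equiv\gamma\Rightarrow\alpha\equiv\alpha(\theta/\gamma)$, where $\alpha(\theta/\gamma)$ is $\alpha$ with occurrences of $\theta$ replaced by $\gamma$. **PALFI1$_C$** = S5LFI1 + PA1–PA5 + the composition axiom $[\alpha][\beta]\gamma\equiv[\alpha\land[\alpha]\beta]\gamma$ (without RE). $\vdash$ denotes derivability from the axioms by the rules. *)

(* Defs.v *)
From mathcomp Require Import all_boot.

Set Implicit Arguments.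
Unset Strict Implicit.
Unset Printing Implicit Defensive.

Inductive form (P N : Type) : Type :=
  | Var of P
  | Neg of form P N
  | Bul of form P N
  | And of form P N & form P N
  | Know of N & form P N
  | Ann of form P N & form P N.

Arguments Var {P N} p.
Arguments Know {P N} i a.

Declare Scope lfi_scope.
Delimit Scope lfi_scope with lfi.
Bind Scope lfi_scope with form.
Local Open Scope lfi_scope.

Notation "¬ a" := (Neg a) (at level 35, right associativity) : lfi_scope.
Notation "● a" := (Bul a) (at level 35, right associativity) : lfi_scope.
Notation "a ∧ b" := (And a b) (at level 50, left associativity) : lfi_scope.
Notation "'K_[' i ] a" := (Know i a)
  (at level 35, i at level 200, a at level 35) : lfi_scope.
Notation "'[!' a ] b" := (Ann a b)
  (at level 35, a at level 200, b at level 35) : lfi_scope.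

Definition Cons (P N : Type) (a : form P N) : form P N := ¬ ● a.
Notation "○ a" := (Cons a) (at level 35, right associativity) : lfi_scope.

Definition Or (P N : Type) (a b : form P N) : form P N := ¬ (¬ a ∧ ¬ b).
Notation "a ∨ b" := (Or a b) (at level 50, left associativity) : lfi_scope.

Definition SNeg (P N : Type) (a : form P N) : form P N := ¬ a ∧ ○ a.
Notation "∼ a" := (SNeg a) (at level 35, right associativity) : lfi_scope.

Definition Imp (P N : Type) (a b : form P N) : form P N := ∼ a ∨ b.
Notation "a ⇒ b" := (Imp a b) (at level 55, right associativity) : lfi_scope.

Definition Iff (P N : Type) (a b : form P N) : form P N :=
  (a ⇒ b) ∧ (b ⇒ a).
Notation "a ⇔ b" := (Iff a b) (at level 60, no associativity) : lfi_scope.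

Definition Equ (P N : Type) (a b : form P N) : form P N :=
  (a ⇔ b) ∧ (¬ a ⇔ ¬ b).
Notation "a ≡ b" := (Equ a b) (at level 60, no associativity) : lfi_scope.

Definition Poss (P N : Type) (i : N) (a : form P N) : form P N := ¬ K_[i] ¬ a.
Notation "'M_[' i ] a" := (Poss i a)
  (at level 35, i at level 200, a at level 35) : lfi_scope.

Inductive s5lfi1_axiom (P N : Type) : form P N -> Prop :=
  | A1 a b : s5lfi1_axiom (a ⇒ b ⇒ a)
  | A2 a b c : s5lfi1_axiom ((a ⇒ b ⇒ c) ⇒ (a ⇒ b) ⇒ a ⇒ c)
  | A3 a b : s5lfi1_axiom (a ⇒ b ⇒ a ∧ b)
  | A4 a b : s5lfi1_axiom (a ∧ b ⇒ a)
  | A5 a b : s5lfi1_axiom (a ∧ b ⇒ b)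
  | A6 a b : s5lfi1_axiom (a ⇒ a ∨ b)
  | A7 a b : s5lfi1_axiom (b ⇒ a ∨ b)
  | A8 a b c : s5lfi1_axiom ((a ⇒ c) ⇒ (b ⇒ c) ⇒ a ∨ b ⇒ c)
  | A9 a b : s5lfi1_axiom (a ∨ (a ⇒ b))
  | A10 a : s5lfi1_axiom (a ∨ ¬ a)
  | A11 a b : s5lfi1_axiom (○ a ⇒ a ⇒ ¬ a ⇒ b)
  | A12 a : s5lfi1_axiom (● a ⇒ a ∧ ¬ a)
  | A13 a : s5lfi1_axiom (¬ ¬ a ⇔ a)
  | A14 a b : s5lfi1_axiom (¬ (a ∨ b) ⇔ ¬ a ∧ ¬ b)
  | A15 a b : s5lfi1_axiom (¬ (a ∧ b) ⇔ ¬ a ∨ ¬ b)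
  | A16 a b : s5lfi1_axiom (¬ (a ⇒ b) ⇔ a ∧ ¬ b)
  | AxK i a b : s5lfi1_axiom (K_[i] (a ⇒ b) ⇒ K_[i] a ⇒ K_[i] b)
  | AxK1 i a b : s5lfi1_axiom (K_[i] (a ⇒ b) ⇒ M_[i] a ⇒ M_[i] b)
  | AxK2 i a b : s5lfi1_axiom (M_[i] (a ∨ b) ⇒ M_[i] a ∨ M_[i] b)
  | AxK3 i a b : s5lfi1_axiom ((M_[i] a ⇒ K_[i] b) ⇒ K_[i] (a ⇒ b))
  | AxT i a : s5lfi1_axiom (K_[i] a ⇒ a)
  | Ax4 i a : s5lfi1_axiom (K_[i] a ⇒ K_[i] K_[i] a)
  | Ax5 i a : s5lfi1_axiom (M_[i] a ⇒ K_[i] M_[i] a)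
  | AxT' i a : s5lfi1_axiom (a ⇒ M_[i] a)
  | Ax4' i a : s5lfi1_axiom (M_[i] M_[i] a ⇒ M_[i] a)
  | Ax5' i a : s5lfi1_axiom (M_[i] K_[i] a ⇒ K_[i] a).

Inductive pa_axiom (P N : Type) : form P N -> Prop :=
  | PA1 a p : pa_axiom ([! a] Var p ≡ (a ⇒ Var p))
  | PA2 a b : pa_axiom ([! a] ¬ b ≡ (a ⇒ ¬ [! a] b))
  | PA3 a b : pa_axiom ([! a] ● b ≡ (a ⇒ ● [! a] b))
  | PA4 a b c : pa_axiom ([! a] (b ∧ c) ≡ [! a] b ∧ [! a] c)
  | PA5 i a b : pa_axiom ([! a] K_[i] b ≡ (a ⇒ K_[i] [! a] b)).

(* [replaces t g a a'] : a' is one of the formulas a(t/g), obtained from a by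
   replacing some occurrences of t (possibly all, possibly none) by g.
   Occurrences inside the announced formula of [! a] b count. *)
Inductive replaces (P N : Type) (t g : form P N) :
    form P N -> form P N -> Prop :=
  | repl_here : replaces t g t g
  | repl_refl a : replaces t g a a
  | repl_neg a a' : replaces t g a a' -> replaces t g (¬ a) (¬ a')
  | repl_bul a a' : replaces t g a a' -> replaces t g (● a) (● a')
  | repl_and a a' b b' : replaces t g a a' -> replaces t g b b' ->
      replaces t g (a ∧ b) (a' ∧ b')
  | repl_know i a a' : replaces t g a a' -> replaces t g (K_[i] a) (K_[i] a')
  | repl_ann a a' b b' : replaces t g a a' -> replaces t g b b' ->
      replaces t g ([! a] b) ([! a'] b').

Inductive PALFI1 (P N : Type) : form P N -> Prop :=
  | PALFI1_base a : s5lfi1_axiom a -> PALFI1 a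
  | PALFI1_pa a : pa_axiom a -> PALFI1 a
  | PALFI1_mp a b : PALFI1 a -> PALFI1 (a ⇒ b) -> PALFI1 b
  | PALFI1_nec i a : PALFI1 a -> PALFI1 (K_[i] a)
  | PALFI1_congK i a b : PALFI1 (a ≡ b) -> PALFI1 (K_[i] a ≡ K_[i] b)
  | PALFI1_RE t g a a' : PALFI1 (t ≡ g) -> replaces t g a a' -> PALFI1 (a ≡ a').

Inductive PALFI1C (P N : Type) : form P N -> Prop :=
  | PALFI1C_base a : s5lfi1_axiom a -> PALFI1C a
  | PALFI1C_pa a : pa_axiom a -> PALFI1C a
  | PALFI1C_comp a b c : PALFI1C ([! a] [! b] c ≡ [! a ∧ [! a] b] c)
  | PALFI1C_mp a b : PALFI1C a -> PALFI1C (a ⇒ b) -> PALFI1C b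
  | PALFI1C_nec i a : PALFI1C a -> PALFI1C (K_[i] a)
  | PALFI1C_congK i a b : PALFI1C (a ≡ b) -> PALFI1C (K_[i] a ≡ K_[i] b).

(* Main.v *)
Require Import Defs.
From mathcomp Require Import all_boot.
From mathcomp Require Import boolp classical_sets.

Set Implicit Arguments.
Unset Strict Implicit.
Unset Printing Implicit Defensive.

(** Call [rel a x] the relativization of an announcement-free [x] to [a], i.e.
   the result of pushing [[! a]] down to the variables, and [tr x] the
   translation that eliminates all announcements, with
   [tr ([! a] x) = rel (tr a) (tr x)].

   From PALFI1_C to PALFI1: by RE every formula is equivalent to its
   translation, so composition reduces to
   [rel a (rel b x) ≡ rel (a ∧ rel a b) x], which S5LFI1 proves.

   From PALFI1 to PALFI1_C: composition gives [[! a] x ≡ rel a (tr x)] by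
   structural induction on [x], without replacement inside announcements.
   Moreover [rel a (tr x)] is provable for every [a] as soon as [x] is, by
   induction on derivations.  Applied to [x ≡ y], this makes announcement a
   congruence, so RE is admissible.

   The propositional reasoning inside S5LFI1 is done semantically: a formula is a
   theorem as soon as all three-valued valuations validating the theorems
   validate it (Lindenbaum's lemma). *)

Section Equivalence.
Variables P N : Type.
Local Notation form := (form P N).
Implicit Types (a b c t g x y : form) (i : N) (T : form -> Prop).
Local Open Scope lfi_scope.

(* The pair (v a, v (¬ a)) is the value of [a] in the three-valued matrix of
   LFI1: (1,0) is 1, (1,1) is 1/2, (0,1) is 0. *)
Record valuation (v : pred form) : Prop := Valuation {
  val_and a b : v (a ∧ b) = v a && v b;
  val_em a : v a || v (¬ a);
  val_notnot a : v (¬ ¬ a) = v a;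
  val_nand a b : v (¬ (a ∧ b)) = v (¬ a) || v (¬ b);
  val_bul a : v (● a) = v a && v (¬ a);
  val_nbul a : v (¬ ● a) = ~~ (v a && v (¬ a)) }.

(** * Derived connectives under three-valued valuations *)

Section Valuations.
Variables (v : pred form) (vP : valuation v).

Lemma val_or a b : v (a ∨ b) = v a || v b.
Proof. by rewrite /Or (val_nand vP) !(val_notnot vP). Qed.

Lemma val_nor a b : v (¬ (a ∨ b)) = v (¬ a) && v (¬ b).
Proof. by rewrite /Or (val_notnot vP) (val_and vP). Qed.

Lemma val_imp a b : v (a ⇒ b) = (v a ==> v b).
Proof.
rewrite /Imp val_or /SNeg (val_and vP) /Defs.Cons (val_nbul vP).
by move: (val_em vP a); case: (v a); case: (v _).
Qed.

Lemma val_nimp a b : v (¬ (a ⇒ b)) = v a && v (¬ b).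
Proof.
rewrite /Imp val_nor /SNeg (val_nand vP) /Defs.Cons !(val_notnot vP) (val_bul vP).
by move: (val_em vP a); case: (v a); case: (v (¬ a)).
Qed.

Lemma val_iff a b : v (a ⇔ b) = (v a == v b).
Proof. by rewrite /Iff (val_and vP) !val_imp; case: (v a); case: (v b). Qed.

Lemma val_equ a b : v (a ≡ b) = (v a == v b) && (v (¬ a) == v (¬ b)).
Proof. by rewrite /Equ (val_and vP) !val_iff. Qed.

Definition valuationE := (val_equ, val_iff, val_imp, val_nimp, val_or, val_nor,
  val_and vP, val_notnot vP, val_nand vP, val_bul vP, val_nbul vP).

End Valuations.

(** The part common to both systems, so that the results on relativization are proved once and apply
    to each. *)
Record s5_logic T : Prop := S5Logic {
  s5_axiom a : s5lfi1_axiom a -> T a;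
  s5_mp a b : T a -> T (a ⇒ b) -> T b;
  s5_nec i a : T a -> T (K_[i] a);
  s5_congK i a b : T (a ≡ b) -> T (K_[i] a ≡ K_[i] b) }.

Definition model T (v : pred form) := valuation v /\ forall a, T a -> v a.

(** * Lindenbaum completeness *)

Section Completeness.
Variables (T : form -> Prop) (TP : s5_logic T).

(** Modus ponens is the only rule; necessitation and the congruence rule stay confined to [T], which
    is what makes the deduction theorem hold. *)
Inductive derives (X : set form) : form -> Prop :=
  | der_thm a : T a -> derives X a
  | der_hyp a : X a -> derives X a
  | der_mp a b : derives X a -> derives X (a ⇒ b) -> derives X b.

Let der_ax X a : s5lfi1_axiom a -> derives X a.
Proof. by move=> /(s5_axiom TP)/der_thm. Qed.

Lemma der_mono X Y a : (X `<=` Y)%classic -> derives X a -> derives Y a.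
Proof.
move=> XY; elim=> {a} [a Ta|a Xa|a b _ IHa _ IHb].
- exact: der_thm.
- exact/der_hyp/XY.
- exact: der_mp IHa IHb.
Qed.

Lemma der_deduction X a b : derives (X `|` [set a])%classic b -> derives X (a ⇒ b).
Proof.
have aa x : derives X (x ⇒ x).
  apply: (der_mp (der_ax X (A1 x x))).
  by apply: (der_mp (der_ax X (A1 x (x ⇒ x)))); apply/der_ax/A2.
have wk x y : derives X y -> derives X (x ⇒ y).
  by move=> /der_mp; apply; apply/der_ax/A1.
elim=> {b} [b Tb|b [Xb|->]|b c _ IHb _ IHc].
- exact/wk/der_thm.
- exact/wk/der_hyp.
- exact: aa.
- by apply: der_mp IHb _; apply: der_mp IHc _; apply/der_ax/A2.
Qed.

(** A derivation uses finitely many hypotheses, and some member of the chain contains them all. The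
    first alternative covers the empty chain. *)
Lemma der_chain (F : set (set form)) a : total_on F subset ->
  derives (\bigcup_(X in F) X)%classic a ->
  derives set0 a \/ exists2 X, F X & derives X a.
Proof.
move=> Ftot; elim=> {a} [a Ta|a [X FX Xa]|a b _ IHa _ IHb].
- by left; apply: der_thm.
- by right; exists X => //; apply: der_hyp.
- case: IHa IHb => [a0|[X FX aX]] [b0|[Y FY bY]].
  + by left; apply: der_mp a0 b0.
  + right; exists Y => //; apply: der_mp bY; exact: der_mono a0.
  + right; exists X => //; apply: der_mp aX _; exact: der_mono b0.
  + right; case: (Ftot _ _ FX FY) => XY.
      by exists Y => //; apply: der_mp bY; exact: der_mono aX.
    by exists X => //; apply: der_mp aX _; exact: der_mono bY.
Qed.

Lemma s5_complete a : (forall v, model T v -> v a) -> T a.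
Proof.
move=> va; apply: contrapT => nTa.
have n0 : ~ derives set0 a.
  by move=> d; apply: nTa; elim: d => // b c _ Tb _ /(s5_mp TP Tb).
have [|A [nAa Amax]] := @Zorn_bigcup form [set X | ~ derives X a]%classic.
  by move=> F FP Ftot /(der_chain Ftot)[/n0|[X /FP]].
(* Maximality: adding a formula outside [A] makes [a] derivable. With A8 this gives primeness of
   [A], stated as [orE]. *)
have imp b : ~ A b -> derives A (b ⇒ a).
  move=> nAb; apply: der_deduction; apply: contrapT => nd.
  apply: (Amax (A `|` [set b])%classic) => //; split; first by move=> x; left.
  by move=> /(_ b (or_intror erefl)).
have closed b : derives A b -> A b.
  by move=> Ab; apply: contrapT => /imp /(der_mp Ab).
have mp b c : A b -> A (b ⇒ c) -> A c.
  by move=> Ab Abc; apply/closed/(der_mp (der_hyp Ab))/der_hyp.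
have ax b : s5lfi1_axiom b -> A b by move=> bax; apply/closed/der_ax.
have iff1 b c : A (b ⇔ c) -> A b -> A c.
  by move=> Abc /mp; apply; apply: (mp _ _ Abc); apply/ax/A4.
have iff2 b c : A (b ⇔ c) -> A c -> A b.
  by move=> Abc /mp; apply; apply: (mp _ _ Abc); apply/ax/A5.
have orl b c : A b -> A (b ∨ c) by move=> /mp; apply; apply/ax/A6.
have orr b c : A c -> A (b ∨ c) by move=> /mp; apply; apply/ax/A7.
have orE b c : A (b ∨ c) -> A b \/ A c.
  move=> Abc; apply: contrapT => /not_orP[/imp db /imp dc]; apply: nAa.
  apply: der_mp (der_hyp Abc) (der_mp dc (der_mp db _)).
  exact/der_ax/A8.
have andI b c : A b -> A c -> A (b ∧ c).
  by move=> Ab /mp; apply; apply: (mp _ _ Ab); apply/ax/A3.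
have andl b c : A (b ∧ c) -> A b by move=> /mp; apply; apply/ax/A4.
have andr b c : A (b ∧ c) -> A c by move=> /mp; apply; apply/ax/A5.
have cons b : A (¬ ● b) -> A b -> A (¬ b) -> False.
  move=> Acb Ab Anb; apply: nAa; apply: der_hyp; apply: (mp _ _ Anb).
  by apply: (mp _ _ Ab); apply: (mp _ _ Acb); apply/ax/A11.
have bul b : A (● b) -> A b /\ A (¬ b).
  by move=> Ab; have Abb := mp _ _ Ab (ax _ (A12 b)); split; [apply: andl Abb|apply: andr Abb].
pose v b := `[< A b >].
(* If membership in [A] is a model, [va] puts [a] into [A], contradicting [nAa]. *)
suff /va /asboolP /der_hyp : model T v by [].
split; last by move=> b Tb; apply/asboolP/closed/der_thm.
have vb b c : (A b <-> A c) -> v b = v c by move=> bc; apply: asbool_equiv_eq.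
split=> [b c|b|b|b c|b|b].
- rewrite /v -asbool_and; apply: asbool_equiv_eq.
  by split=> [Abc|[]]; [split; [exact: andl Abc|exact: andr Abc]|exact: andI].
- by rewrite /v -asbool_or; apply/asboolP/orE/ax/A10.
- by apply: vb; split; [apply/iff1|apply/iff2]; apply/ax/A13.
- rewrite /v -asbool_or; apply: asbool_equiv_eq.
  have /iff1 H1 := ax _ (A15 b c); have /iff2 H2 := ax _ (A15 b c).
  by split=> [/H1/orE //|[H|H]]; apply: H2; [apply: orl|apply: orr].
- rewrite /v -asbool_and; apply: asbool_equiv_eq; split=> [/bul //|[Ab Anb]].
  by have [//|/cons/(_ Ab Anb)] : A (● b) \/ A (¬ ● b) by apply/orE/ax/A10.
- rewrite /v -asbool_and -asbool_neg; apply: asbool_equiv_eq.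
  split=> [Ab [] //|nb]; first exact: cons.
  by have [/bul|] : A (● b) \/ A (¬ ● b) by apply/orE/ax/A10.
Qed.

End Completeness.

Lemma equ_model T (TP : s5_logic T) a b v : T (a ≡ b) -> model T v ->
  v a = v b /\ v (¬ a) = v (¬ b).
Proof.
by move=> Tab [vP /(_ _ Tab)]; rewrite (val_equ vP) => /andP[/eqP-> /eqP->].
Qed.

Lemma model_equ T (TP : s5_logic T) a b :
  (forall v, model T v -> v a = v b /\ v (¬ a) = v (¬ b)) -> T (a ≡ b).
Proof.
move=> ab; apply: (s5_complete TP) => v vM.
by rewrite (val_equ vM.1) (ab v vM).1 (ab v vM).2 !eqxx.
Qed.

(* On [[! b] c], where it only has to be total, [rel] treats the formula as a
   variable, which keeps the lemmas below free of side conditions. *)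
Fixpoint rel a x : form :=
  match x with
  | Var p => a ⇒ Var p
  | ¬ b => a ⇒ ¬ rel a b
  | ● b => a ⇒ ● rel a b
  | b ∧ c => rel a b ∧ rel a c
  | Know i b => a ⇒ K_[i] rel a b
  | Ann b c => a ⇒ [! b] c
  end.

Fixpoint tr x : form :=
  match x with
  | Var p => Var p
  | ¬ b => ¬ tr b
  | ● b => ● tr b
  | b ∧ c => tr b ∧ tr c
  | Know i b => K_[i] tr b
  | Ann b c => rel (tr b) (tr c)
  end.

(* Where [a] is not designated, [rel a x] takes the value 1, whatever [x] is. *)
Lemma rel_false v a x : valuation v -> ~~ v a ->
  v (rel a x) /\ v (¬ rel a x) = false.
Proof.
move=> vP /negbTE na; elim: x => [p|b IH|b IH|b IHb c IHc|i b IH|b IHb c IHc] /=;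
  rewrite !(valuationE vP) ?na //.
by case: IHb IHc => -> -> [-> ->].
Qed.

(** Once [a] is designated, a guard [a ⇒ _] changes neither a formula's value nor that of its
    negation. Together with [rel_false], this yields the case split used throughout. *)
Lemma rel_valuation v a : valuation v -> v a -> valuation (fun x => v (rel a x)).
Proof.
by move=> vP va; split=> * /=; rewrite !(valuationE vP) ?va //= (val_em vP).
Qed.

(** * Relativization in S5LFI1 theories *)

Section Relativization.
Variables (T : form -> Prop) (TP : s5_logic T).

Lemma s5_equ_trans a b c : T (a ≡ b) -> T (b ≡ c) -> T (a ≡ c).
Proof.
move=> ab bc; apply: (model_equ TP) => v vM.
have [-> ->] := equ_model TP ab vM; exact: (equ_model TP bc vM).
Qed.

Lemma s5_equ_sym a b : T (a ≡ b) -> T (b ≡ a).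
Proof.
by move=> ab; apply: (model_equ TP) => v vM; have [-> ->] := equ_model TP ab vM.
Qed.

Lemma s5_equ_refl a : T (a ≡ a).
Proof. exact: model_equ. Qed.

Lemma equ_neg a b : T (a ≡ b) -> T (¬ a ≡ ¬ b).
Proof.
move=> ab; apply: (model_equ TP) => v vM; have [ea ena] := equ_model TP ab vM.
by rewrite !(valuationE vM.1).
Qed.

Lemma equ_bul a b : T (a ≡ b) -> T (● a ≡ ● b).
Proof.
move=> ab; apply: (model_equ TP) => v vM; have [ea ena] := equ_model TP ab vM.
by rewrite !(valuationE vM.1) ea ena.
Qed.

Lemma equ_and a b c d : T (a ≡ b) -> T (c ≡ d) -> T (a ∧ c ≡ b ∧ d).
Proof.
move=> ab cd; apply: (model_equ TP) => v vM.
have [ea ena] := equ_model TP ab vM; have [ec enc] := equ_model TP cd vM.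
by rewrite !(valuationE vM.1) ea ena ec enc.
Qed.

Lemma equ_imp a b c d : T (a ≡ b) -> T (c ≡ d) -> T ((a ⇒ c) ≡ (b ⇒ d)).
Proof.
move=> ab cd; apply: (model_equ TP) => v vM.
have [ea ena] := equ_model TP ab vM; have [ec enc] := equ_model TP cd vM.
by rewrite !(valuationE vM.1) ea ec enc.
Qed.

Lemma rel_equ_ann a b x : T (a ≡ b) -> T (rel a x ≡ rel b x).
Proof.
move=> ab; elim: x => [p|x IH|x IH|x IHx y IHy|i x IH|x _ y _] /=.
- exact/equ_imp/s5_equ_refl.
- exact/equ_imp/equ_neg.
- exact/equ_imp/equ_bul.
- exact: equ_and.
- exact/equ_imp/(s5_congK TP).
- exact/equ_imp/s5_equ_refl.
Qed.

(** The sides differ syntactically, since [rel] guards every negation and [●] hidden in [⇒]. They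
    agree by cases on whether [a] is designated. *)
Lemma rel_imp a b c : T (rel a (b ⇒ c) ≡ (rel a b ⇒ rel a c)).
Proof.
apply: (model_equ TP) => v [vP _]; have [va|na] := boolP (v a).
  have wP := rel_valuation vP va; split; first by rewrite (val_imp wP) (val_imp vP).
  by have := val_nimp wP b c; rewrite (val_nimp vP) /= (val_imp vP) va (val_imp vP) va.
have rF x := rel_false x vP na.
have [-> ->] := rF (b ⇒ c); have [[hb _] [hc hnc]] := (rF b, rF c).
by rewrite (val_imp vP) (val_nimp vP) hb hc hnc.
Qed.

Lemma rel_comp a b x : T (rel a (rel b x) ≡ rel (a ∧ rel a b) x).
Proof.
(* Every clause of [rel] except conjunction is guarded; the guards [a] and [rel a b] merge into one
   by currying. *)
have step y y' z : rel a y = (a ⇒ y') -> T (y' ≡ z) ->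
    T (rel a (b ⇒ y) ≡ (a ∧ rel a b ⇒ z)).
  move=> ry yz; apply: (s5_equ_trans (rel_imp a b y)); rewrite ry.
  apply: (model_equ TP) => v vM; have [e1 e2] := equ_model TP yz vM.
  rewrite !(valuationE vM.1) e1 e2.
  by case: (v a); case: (v (rel a b)).
elim: x => [p|x IH|x IH|x IHx y IHy|i x IH|x _ y _].
- exact: (step (Var p) _ _ erefl (s5_equ_refl _)).
- exact: (step (¬ rel b x) _ _ erefl (equ_neg IH)).
- exact: (step (● rel b x) _ _ erefl (equ_bul IH)).
- exact: equ_and.
- exact: (step (K_[i] rel b x) _ _ erefl (s5_congK TP i IH)).
- exact: (step ([! x] y) _ _ erefl (s5_equ_refl _)).
Qed.

(** Turns preservation of theorems under relativization into congruence: the valuation induced by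
    [rel a] gives [x] and [y] the same value, and both sides have value 1 where [a] is not
    designated. *)
Lemma equ_rel a x y : (forall b, T (rel b (x ≡ y))) -> T (rel a x ≡ rel a y).
Proof.
move=> xy; apply: (model_equ TP) => v [vP vT]; have [va|na] := boolP (v a).
  have wP := rel_valuation vP va.
  have := vT _ (xy a); rewrite (val_equ wP) /= !(val_imp vP) va /=.
  by case/andP=> /eqP-> /eqP->.
by have [-> ->] := rel_false x vP na; have [-> ->] := rel_false y vP na.
Qed.

(** * Modal monotonicity and preservation of the axioms *)

(** The premise ranges over all models, so completeness makes [a ⇒ b] a theorem, to which
    necessitation applies. Modal steps can thus be argued by valuations, without possible worlds. *)
Lemma s5_monoK i a b v : model T v -> (forall w, model T w -> w a -> w b) ->
  v (K_[i] a) -> v (K_[i] b).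
Proof.
move=> [vP vT] ab; have /(s5_nec TP i)/vT Kab : T (a ⇒ b).
  by apply: (s5_complete TP) => w wM; rewrite (val_imp wM.1); apply/implyP/ab.
have := vT _ (s5_axiom TP (AxK i a b)).
by rewrite !(val_imp vP) Kab /= => /implyP.
Qed.

Lemma s5_monoM i a b v : model T v -> (forall w, model T w -> w a -> w b) ->
  v (M_[i] a) -> v (M_[i] b).
Proof.
move=> [vP vT] ab; have /(s5_nec TP i)/vT Kab : T (a ⇒ b).
  by apply: (s5_complete TP) => w wM; rewrite (val_imp wM.1); apply/implyP/ab.
have := vT _ (s5_axiom TP (AxK1 i a b)).
by rewrite !(val_imp vP) Kab /= => /implyP.
Qed.

Lemma rel_know v i a x : model T v -> v a ->
  v (rel a (K_[i] x)) = v (K_[i] rel a x).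
Proof. by move=> [vP _] va /=; rewrite (val_imp vP) va. Qed.

(* Dualizing [a ⇒ _] under [¬ K_[i] ¬ _] gives [a ∧ _] only up to designation
   and not up to [≡], which is why monotonicity is used instead of congruence. *)
Lemma rel_poss v i a x : model T v -> v a ->
  v (rel a (M_[i] x)) = v (M_[i] (a ∧ rel a x)).
Proof.
move=> vM va; have [vP _] := vM; rewrite /Poss /= !(valuationE vP) va /=.
(* Double negation under [K_[i]] presents the left side as [M_[i]] of [¬ (a ⇒ ¬ rel a x)], which is
   designated exactly when [a ∧ rel a x] is. *)
have nn z : T (z ≡ ¬ ¬ z).
  by apply: (model_equ TP) => w [wP _]; rewrite !(val_notnot wP).
have [_ ->] := equ_model TP (s5_congK TP i (nn (a ⇒ ¬ rel a x))) vM.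
apply/idP/idP; apply: s5_monoM => // w [wP _]; rewrite !(valuationE wP) //.
Qed.

Ltac valuation_cases w wP := rewrite !(valuationE wP);
  repeat match goal with
  | |- context [w (Neg ?y)] =>
      move: (val_em wP y); case: (w y); case: (w (Neg y))
  | |- context [w ?y] => case: (w y)
  end.

(** Propositional axioms hold by truth table in the valuation induced by [rel a]. There [K_[i] y]
    reads as [K_[i] rel a y] and [M_[i] y] as [M_[i] (a ∧ rel a y)], so each modal axiom comes from
    an instance of itself, adjusted where needed by monotonicity. *)
Lemma rel_axiom a x : s5lfi1_axiom x -> T (rel a x).
Proof.
move=> ax; apply: (s5_complete TP) => v vM; have [vP vT] := vM.
have [va|na] := boolP (v a); last by case: (rel_false x vP na).
pose w x := v (rel a x); have wP : valuation w by exact: rel_valuation.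
rewrite -[v _]/(w x).
have wK i y : w (K_[i] y) = v (K_[i] rel a y) by exact: rel_know.
have wM i y : w (M_[i] y) = v (M_[i] (a ∧ rel a y)) by exact: rel_poss.
have vax y : s5lfi1_axiom y -> v y by move=> /(s5_axiom TP)/vT.
have impR u y z : model T u -> u (rel a (y ⇒ z)) = (u (rel a y) ==> u (rel a z)).
  by move=> uM; rewrite (equ_model TP (rel_imp a y z) uM).1 (val_imp uM.1).
have relI u y : model T u -> (u a -> u (rel a y)) -> u (rel a y).
  by move=> [uP _] ua; have [/ua|/(rel_false y uP)[->]] := boolP (u a).
case: ax; try by move=> *; valuation_cases w wP.
- move=> i b c; have := vax _ (AxK i (rel a b) (rel a c)).
  rewrite !(val_imp vP) !(val_imp wP) !wK.
  by rewrite (equ_model TP (s5_congK TP i (rel_imp a b c)) vM).1.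
- move=> i b c; have := vax _ (AxK1 i (a ∧ rel a b) (a ∧ rel a c)).
  rewrite !(val_imp vP) !(val_imp wP) !wK !wM => /implyP H; apply/implyP => h; apply: H.
  apply: s5_monoK h => // u uM; rewrite impR // (val_imp uM.1) !(val_and uM.1).
  by case: (u a).
- move=> i b c; have := vax _ (AxK2 i (a ∧ rel a b) (a ∧ rel a c)).
  rewrite !(val_imp vP) !(val_imp wP) (val_or vP) (val_or wP) !wM => /implyP H.
  apply/implyP => h; apply: H; apply: s5_monoM h => // u [uP _].
  by rewrite (val_or uP) !(val_and uP) => /andP[ua]; rewrite (val_or (rel_valuation uP ua)) ua.
- move=> i b c; have := vax _ (AxK3 i (a ∧ rel a b) (rel a c)).
  rewrite !(val_imp vP) !(val_imp wP) !wK wM => /implyP H; apply/implyP => /H.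
  apply: s5_monoK => // u uM; rewrite (val_imp uM.1) (val_and uM.1) => h.
  by apply: relI => // ua; rewrite impR //; move: h; rewrite ua.
- move=> i b; have := vax _ (AxT i (rel a b)).
  by rewrite (val_imp vP) (val_imp wP) wK.
- move=> i b; have := vax _ (Ax4 i (rel a b)).
  rewrite (val_imp vP) (val_imp wP) !wK => /implyP H; apply/implyP => /H.
  by apply: s5_monoK => // u uM h; apply: relI => // ua; rewrite rel_know.
- move=> i b; have := vax _ (Ax5 i (a ∧ rel a b)).
  rewrite (val_imp vP) (val_imp wP) wK wM => /implyP H; apply/implyP => /H.
  by apply: s5_monoK => // u uM h; apply: relI => // ua; rewrite rel_poss.
- move=> i b; have := vax _ (AxT' i (a ∧ rel a b)).
  by rewrite (val_imp vP) (val_imp wP) wM (val_and vP) va.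
- move=> i b; have := vax _ (Ax4' i (a ∧ rel a b)).
  rewrite (val_imp vP) (val_imp wP) !wM => /implyP H; apply/implyP => h; apply: H.
  apply: s5_monoM h => // u uM.
  by rewrite (val_and uM.1) => /andP[ua]; rewrite rel_poss.
- move=> i b; have := vax _ (Ax5' i (rel a b)).
  rewrite (val_imp vP) (val_imp wP) wM wK => /implyP H; apply/implyP => h; apply: H.
  apply: s5_monoM h => // u uM.
  by rewrite (val_and uM.1) => /andP[ua]; rewrite rel_know.
Qed.

Lemma tr_axiom x : s5lfi1_axiom x -> s5lfi1_axiom (tr x).
Proof. by case=> *; constructor. Qed.

Lemma rel_congK i a x y : (forall b, T (rel b (x ≡ y))) ->
  T (rel a (K_[i] x ≡ K_[i] y)).
Proof.
move=> xy; apply: (s5_complete TP) => v vM; have [vP vT] := vM.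
have [va|na] := boolP (v a); last by case: (rel_false (K_[i] x ≡ K_[i] y) vP na).
have := val_equ (rel_valuation vP va) (K_[i] x) (K_[i] y).
cbn beta => ->; have [e1 e2] := equ_model TP (s5_congK TP i (equ_rel a xy)) vM.
by rewrite /= !(valuationE vP) va /= e1 e2 !eqxx.
Qed.

(** Repeated use of [rel_comp] collapses each side under [rel a] to a single relativization of [x];
    the two announced formulas then differ only by associativity of [∧]. *)
Lemma rel_rel_comp a b c x :
  T (rel a (rel b (rel c x) ≡ rel (b ∧ rel b c) x)).
Proof.
apply: (s5_complete TP) => v vM; have [vP vT] := vM.
have [va|na] := boolP (v a);
  last by case: (rel_false (rel b (rel c x) ≡ rel (b ∧ rel b c) x) vP na).
have := val_equ (rel_valuation vP va) (rel b (rel c x)) (rel (b ∧ rel b c) x).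
cbn beta => ->.
suff e : T (rel a (rel b (rel c x)) ≡ rel a (rel (b ∧ rel b c) x)).
  have [e1 e2] := equ_model TP e vM.
  by rewrite e1 /= !(val_imp vP) va e2 !eqxx.
apply: (s5_equ_trans (rel_comp _ _ _)).
apply: (s5_equ_trans (rel_comp _ _ _)).
apply: s5_equ_sym.
apply: (s5_equ_trans (rel_comp _ _ _)).
apply: rel_equ_ann; rewrite [rel a (_ ∧ _)]/=.
apply: (s5_equ_trans (equ_and (s5_equ_refl _)
  (equ_and (s5_equ_refl _) (rel_comp _ _ _)))).
apply: (model_equ TP) => u [uP _]; rewrite !(valuationE uP).
by rewrite !andbA !orbA.
Qed.

End Relativization.

Lemma PALFI1_s5 : s5_logic (@PALFI1 P N).
Proof.
split; [exact: PALFI1_base|exact: PALFI1_mp|exact: PALFI1_nec|exact: PALFI1_congK].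
Qed.

Lemma PALFI1C_s5 : s5_logic (@PALFI1C P N).
Proof.
split; [exact: PALFI1C_base|exact: PALFI1C_mp|exact: PALFI1C_nec|exact: PALFI1C_congK].
Qed.

(** * Reduction and admissibility of RE in PALFI1_C *)

Lemma PALFI1C_ann a x : PALFI1C ([! a] x ≡ rel a (tr x)).
Proof.
have S := PALFI1C_s5; have trans := s5_equ_trans S; have refl := s5_equ_refl S.
elim: x a => [p|x IH|x IH|x IHx y IHy|i x IH|x IHx y IHy] a.
- exact/PALFI1C_pa/PA1.
- by apply: (trans _ _ _ (PALFI1C_pa (PA2 _ _)));
  apply: (equ_imp S) => //; apply: (equ_neg S).
- by apply: (trans _ _ _ (PALFI1C_pa (PA3 _ _)));
  apply: (equ_imp S) => //; apply: (equ_bul S).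
- by apply: (trans _ _ _ (PALFI1C_pa (PA4 _ _ _))); apply: (equ_and S).
- by apply: (trans _ _ _ (PALFI1C_pa (PA5 _ _ _)));
  apply: (equ_imp S) => //; apply: PALFI1C_congK.
(* Composition merges the two announcements, so the hypothesis on [y] is needed at [a ∧ [! a] x].
   The hypothesis on [x] is then applied inside [rel], where [rel_equ_ann] permits replacement. *)
- apply: (trans _ _ _ (PALFI1C_comp a x y)).
  apply: (trans _ _ _ (IHy (a ∧ [! a] x))).
  apply: (trans _ _ _ _ (s5_equ_sym S (rel_comp S a (tr x) (tr y)))).
  by apply: (rel_equ_ann S) => //; apply: (equ_and S).
Qed.

Lemma PALFI1C_rel a x : PALFI1C x -> PALFI1C (rel a (tr x)).
Proof.
have S := PALFI1C_s5; move=> Tx.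
elim: Tx a => {x} [x ax|x ax|b c d|x y _ IHx _ IHy|i x _ IH|i x y _ IH] a.
- exact/(rel_axiom S)/tr_axiom.
(* The two sides of each reduction axiom have literally the same translation. *)
- suff [y ->] : exists y, tr x = (y ≡ y).
    apply: (s5_complete S) => v [vP _]; have [va|na] := boolP (v a).
      by have := val_equ (rel_valuation vP va) y y; cbn beta => ->; rewrite !eqxx.
    by case: (rel_false (y ≡ y) vP na).
  by case: ax => *; eexists; reflexivity.
- exact: (rel_rel_comp S).
- apply: (s5_mp S (IHx a)); apply: (s5_mp S (IHy a)).
  apply: (s5_complete S) => v vM.
  have := equ_model S (rel_imp S a (tr x) (tr y)) vM => -[e _].
  by rewrite (val_imp vM.1) e; apply/implyP.
- apply: (s5_complete S) => v [vP vT] /=; rewrite (val_imp vP).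
  by apply/implyP => _; apply/vT/(s5_nec S)/IH.
- exact: (rel_congK S).
Qed.

Lemma PALFI1C_equ_ann a b x y : PALFI1C (a ≡ b) -> PALFI1C (x ≡ y) ->
  PALFI1C ([! a] x ≡ [! b] y).
Proof.
have S := PALFI1C_s5; move=> ab xy.
apply: (s5_equ_trans S (PALFI1C_ann a x)).
apply: (s5_equ_trans S (rel_equ_ann S _ ab)).
apply: (s5_equ_trans S _ (s5_equ_sym S (PALFI1C_ann b y))).
(* [tr] commutes with [≡] by computation, so relativizing the theorem [x ≡ y] gives the premise of
   [equ_rel]. *)
by apply: (equ_rel S) => c; apply: (PALFI1C_rel c xy).
Qed.

Lemma PALFI1C_RE t g x y : PALFI1C (t ≡ g) -> replaces t g x y ->
  PALFI1C (x ≡ y).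
Proof.
have S := PALFI1C_s5; move=> tg.
elim=> {x y} [|x|x y _ IH|x y _ IH|x x' y y' _ IHx _ IHy|i x y _ IH|x x' y y' _ IHx _ IHy] //.
- exact: (s5_equ_refl S).
- exact: (equ_neg S).
- exact: (equ_bul S).
- exact: (equ_and S).
- exact: PALFI1C_congK.
- exact: PALFI1C_equ_ann.
Qed.

(** * Elimination of announcements in PALFI1 *)

Fixpoint ann_free x : bool :=
  match x with
  | Var _ => true
  | ¬ b => ann_free b
  | ● b => ann_free b
  | b ∧ c => ann_free b && ann_free c
  | Know _ b => ann_free b
  | Ann _ _ => false
  end.

Lemma ann_free_rel a x : ann_free a -> ann_free x -> ann_free (rel a x).
Proof.
move=> fa; elim: x => [p|x IH|x IH|x IHx y IHy|i x IH|//] /=; rewrite ?fa //.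
by case/andP=> /IHx-> /IHy->.
Qed.

Lemma ann_free_tr x : ann_free (tr x).
Proof.
by elim: x => //= [x -> y -> //|x IHx y IHy]; apply: ann_free_rel.
Qed.

(** PA1-PA5 have no clause for an announcement under an announcement, hence the restriction on [x];
    inner announcements are removed first by RE. *)
Lemma PALFI1_ann_free a x : ann_free x -> PALFI1 ([! a] x ≡ rel a x).
Proof.
have S := PALFI1_s5; have trans := s5_equ_trans S; have refl := s5_equ_refl S.
elim: x => [p _|x IH /IH ?|x IH /IH ?|x IHx y IHy /andP[/IHx ? /IHy ?]|i x IH /IH ?|//].
- exact/PALFI1_pa/PA1.
- by apply: (trans _ _ _ (PALFI1_pa (PA2 _ _)));
  apply: (equ_imp S) => //; apply: (equ_neg S).
- by apply: (trans _ _ _ (PALFI1_pa (PA3 _ _)));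
  apply: (equ_imp S) => //; apply: (equ_bul S).
- by apply: (trans _ _ _ (PALFI1_pa (PA4 _ _ _))); apply: (equ_and S).
- by apply: (trans _ _ _ (PALFI1_pa (PA5 _ _ _)));
  apply: (equ_imp S) => //; apply: PALFI1_congK.
Qed.

(** The one appeal to RE: replacement behind an announcement. Replacement under the other
    connectives already holds in every S5LFI1 theory. *)
Lemma PALFI1_equ_ann a x y : PALFI1 (x ≡ y) -> PALFI1 ([! a] x ≡ [! a] y).
Proof.
by move=> xy; apply: (PALFI1_RE xy); apply: repl_ann; [apply: repl_refl|apply: repl_here].
Qed.

Lemma PALFI1_tr x : PALFI1 (x ≡ tr x).
Proof.
have S := PALFI1_s5.
elim: x => [p|x IH|x IH|x IHx y IHy|i x IH|x IHx y IHy].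
- exact: (s5_equ_refl S).
- exact: (equ_neg S).
- exact: (equ_bul S).
- exact: (equ_and S).
- exact: PALFI1_congK.
(* Innermost first: [y] is translated in place, the announcement is pushed down, and only then is
   the announced [x] translated, inside [rel]. *)
- apply: (s5_equ_trans S (PALFI1_equ_ann x IHy)).
  apply: (s5_equ_trans S (PALFI1_ann_free x (ann_free_tr y))).
  exact: (rel_equ_ann S).
Qed.

Lemma PALFI1_ann a x : PALFI1 ([! a] x ≡ rel a (tr x)).
Proof.
have S := PALFI1_s5.
apply: (s5_equ_trans S (PALFI1_equ_ann a (PALFI1_tr x))).
exact/PALFI1_ann_free/ann_free_tr.
Qed.

Lemma PALFI1_comp a b x : PALFI1 ([! a] [! b] x ≡ [! a ∧ [! a] b] x).
Proof.
have S := PALFI1_s5.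
apply: (s5_equ_trans S (PALFI1_ann _ _)).
apply: (s5_equ_trans S (rel_comp S _ _ _)).
apply: (s5_equ_trans S _ (s5_equ_sym S (PALFI1_ann _ _))).
apply: (rel_equ_ann S) => //; apply: (equ_and S) => //; first exact: (s5_equ_refl S).
exact/(s5_equ_sym S)/PALFI1_ann.
Qed.

End Equivalence.

Theorem theorem52 (P : countType) (N : finType) (a : form P N) :
  PALFI1 a <-> PALFI1C a.
Proof.
split; elim=> {a}.
- exact: PALFI1C_base.
- exact: PALFI1C_pa.
- by move=> a b _ ? _; apply: PALFI1C_mp.
- by move=> i a _; apply: PALFI1C_nec.
- by move=> i a b _; apply: PALFI1C_congK.
- by move=> t g a b _; apply: PALFI1C_RE.
- exact: PALFI1_base.
- exact: PALFI1_pa.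
- exact: PALFI1_comp.
- by move=> a b _ ? _; apply: PALFI1_mp.
- by move=> i a _; apply: PALFI1_nec.
- by move=> i a b _; apply: PALFI1_congK.
Qed.
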